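(* Let $X$ be a real Banach space containing an isomorphic copy of $c_0$. Then there exists an equivalent norm $|\cdot|$ on $X$ for which there exists $h\in S_{X^{****}}$ such that $|x+h|=\max\{|x|,1\}$ for every $x\in X$.
   Context: All Banach spaces are real. $X^{****}$ denotes the fourth dual of $X$, and $X$ is identified with its canonical image in $X^{****}$. The norm on $X^{****}$ in the statement (also denoted $|\cdot|$) is the fourth dual norm of $(X,|\cdot|)$, and $S_{X^{****}}$ is the unit sphere of $X^{****}$ for this norm. Containing an isomorphic copy of $c_0$ means having a closed subspace linearly homeomorphic to $c_0$. *)

(* Defs.v *)
From HB Require Import structures.
From mathcomp Require Import all_boot all_order all_algebra.
From mathcomp Require Import all_classical all_reals all_analysis.

Set Implicit Arguments.
Unset Strict Implicit.
Unset Printing Implicit Defensive.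

Import Order.TTheory GRing.Theory Num.Theory.
Import numFieldNormedType.Exports.

Local Open Scope classical_set_scope.
Local Open Scope ring_scope.

Section Dual.
Context {R : realType} (X : normedModType R).

Definition dual_pred : {pred X -> R^o} :=
  mem [set f : X -> R^o | linear f /\ continuous f].

Record dual :=
  Dual { dual_fun :> X -> R^o ; dual_funP : dual_fun \in dual_pred }.

HB.instance Definition _ := [isSub for dual_fun].
HB.instance Definition _ := [Choice of dual by <:].

Lemma dual_submod_closed : submod_closed dual_pred.
Proof.
split.
  apply/mem_set; split; last exact: cst_continuous.
  by move=> a x y; rewrite /= scaler0 addr0.
move=> a f g /set_mem[fl fc] /set_mem[gl gc]; apply/mem_set; split.
  move=> b x y; rewrite /= !fctE fl gl !scalerDr !scalerA (mulrC a b) !addrA.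
  by congr (_ + _); rewrite -!addrA; congr (_ + _); rewrite addrC.
move=> x; apply: (@continuousD R R^o X (fun y => a *: f y) g x); last exact: gc.
by apply: (@continuousZl_tmp R R^o X f a x); exact: fc.
Qed.

HB.instance Definition _ :=
  GRing.isSubmodClosed.Build R (X -> R^o) dual_pred dual_submod_closed.
HB.instance Definition _ := [SubChoice_isSubLmodule of dual by <:].

Lemma dual_linear (f : dual) : linear f.
Proof. by have /set_mem[] := dual_funP f. Qed.

Lemma dual_continuous (f : dual) : continuous f.
Proof. by have /set_mem[] := dual_funP f. Qed.

Lemma dual0 (f : dual) : f 0 = 0.
Proof.
have := dual_linear f 1 0 0; rewrite !scale1r addr0 => /esym/eqP.
by rewrite -subr_eq0 addrK => /eqP.
Qed.

Lemma dualZ (f : dual) a x : f (a *: x) = a *: f x.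
Proof. by have := dual_linear f a x 0; rewrite !addr0 dual0 addr0. Qed.

Definition dual_norm (f : dual) : R :=
  sup [set `|f x| | x in [set x | `|x| <= 1]].

Lemma dual_norm_has_sup (f : dual) :
  has_sup [set `|f x| | x in [set x | `|x| <= 1]].
Proof.
split; first by exists `|f 0|, 0 => //=; rewrite normr0.
pose g : {linear X -> R^o} :=
  HB.pack (f : X -> R^o) (GRing.isLinear.Build _ _ _ _ _ (dual_linear f)).
have /linear_bounded_continuous/bounded_funP/(_ 1)[M HM] : continuous g.
  exact: dual_continuous.
by exists M => _ [x /= x1 <-]; exact: HM.
Qed.

Lemma dual_norm_ub (f : dual) x : `|x| <= 1 -> `|f x| <= dual_norm f.
Proof.
by move=> x1; apply: (sup_upper_bound (dual_norm_has_sup f)); exists x.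
Qed.

Lemma dual_norm_le (f : dual) (c : R) :
  (forall x, `|x| <= 1 -> `|f x| <= c) -> dual_norm f <= c.
Proof.
move=> H; apply: ge_sup; first by case: (dual_norm_has_sup f).
by move=> _ [x /= x1 <-]; exact: H.
Qed.

Lemma dual_norm_apply (f : dual) x : `|f x| <= dual_norm f * `|x|.
Proof.
have [->|x0] := eqVneq x 0; first by rewrite dual0 !normr0 mulr0.
have nx : 0 < `|x| by rewrite normr_gt0.
rewrite -ler_pdivrMr//.
have := @dual_norm_ub f (`|x|^-1 *: x).
rewrite dualZ !normrZ normfV normr_id mulVf ?gt_eqF// mulrC; exact.
Qed.

Lemma ler_dual_normD f g : dual_norm (f + g) <= dual_norm f + dual_norm g.
Proof.
apply: dual_norm_le => x x1; apply: (le_trans (ler_normD _ _)).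
by apply: lerD; exact: dual_norm_ub.
Qed.

Lemma dual_normZ (a : R) f : dual_norm (a *: f) = `|a| * dual_norm f.
Proof.
have le b h : dual_norm (b *: h) <= `|b| * dual_norm h.
  apply: dual_norm_le => x x1; rewrite [(b *: h) x]/(b * h x) normrM.
  by rewrite ler_wpM2l//; exact: dual_norm_ub.
apply/eqP; rewrite eq_le le /=.
have [->|a0] := eqVneq a 0.
  rewrite normr0 mul0r; apply: le_trans (dual_norm_ub (0 *: f) (x := 0) _) => //.
  by rewrite normr0.
have na : 0 < `|a| by rewrite normr_gt0.
rewrite -ler_pdivlMl// -normfV.
by have := le a^-1 (a *: f); rewrite scalerA mulVf// scale1r.
Qed.

Lemma dual_norm0_eq0 f : dual_norm f = 0 -> f = 0.
Proof.
move=> f0; apply/val_inj/funext => x /=; apply/eqP; rewrite -normr_le0.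
by have := dual_norm_apply f x; rewrite f0 mul0r.
Qed.

HB.instance Definition _ := Lmodule_isNormed.Build R dual
  ler_dual_normD dual_normZ dual_norm0_eq0.

Lemma dual_normE (f : dual) :
  `|f| = sup [set `|f x| | x in [set x | `|x| <= 1]].
Proof. by []. Qed.

End Dual.

(* The canonical image of X in its bidual. *)
Section Evaluation.
Context {R : realType} (X : normedModType R).

Lemma bidual_embed_subproof (x : X) :
  (fun f : dual X => f x : R^o) \in dual_pred (X := dual X).
Proof.
have lin : linear (fun f : dual X => f x : R^o) by [].
apply/mem_set; split => //.
pose g : {linear dual X -> R^o} :=
  HB.pack (fun f : dual X => f x : R^o) (GRing.isLinear.Build _ _ _ _ _ lin).
suff : continuous g by [].
apply/linear_bounded_continuous/bounded_funP => r; exists (r * `|x|) => f fr.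
by apply: (le_trans (dual_norm_apply f x)); rewrite ler_wpM2r.
Qed.

Definition bidual_embed (x : X) : dual (dual X) := Dual (bidual_embed_subproof x).

End Evaluation.

Section C0.
Context (R : realType).

Definition c0_pred : {pred nat -> R^o} :=
  mem [set u : nat -> R^o | u @ \oo --> (0 : R^o)].

Record c0 := C0 { c0_seq :> nat -> R^o ; c0_seqP : c0_seq \in c0_pred }.

HB.instance Definition _ := [isSub for c0_seq].
HB.instance Definition _ := [Choice of c0 by <:].

Lemma c0_submod_closed : submod_closed c0_pred.
Proof.
split; first by apply/mem_set; exact: cvg_cst.
move=> a u v /set_mem /= uc /set_mem /= vc; apply/mem_set => /=.
rewrite -[0](addr0 (0 : R^o)) -[X in _ --> X + _](scaler0 _ a).
by apply: cvgD => //; exact: cvgZl_tmp.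
Qed.

HB.instance Definition _ :=
  GRing.isSubmodClosed.Build R (nat -> R^o) c0_pred c0_submod_closed.
HB.instance Definition _ := [SubChoice_isSubLmodule of c0 by <:].

Definition c0_norm (u : c0) : R := sup (range (fun n => `|u n|)).

Lemma c0_cvg (u : c0) : (u : nat -> R^o) @ \oo --> (0 : R^o).
Proof. by have /set_mem := c0_seqP u. Qed.

Lemma c0_norm_has_sup (u : c0) : has_sup (range (fun n => `|u n|)).
Proof.
split; first by exists `|u 0%N|, 0%N.
have [M [_ HM]] : bounded_fun (u : nat -> R^o).
  by apply: cvg_seq_bounded; apply/cvg_ex; exists 0; exact: c0_cvg.
by exists (M + 1) => _ [n _ <-]; apply: (HM (M + 1)); rewrite ?ltrDl.
Qed.

Lemma c0_norm_ub (u : c0) n : `|u n| <= c0_norm u.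
Proof. by apply: (sup_upper_bound (c0_norm_has_sup u)); exists n. Qed.

Lemma c0_norm_le (u : c0) (c : R) : (forall n, `|u n| <= c) -> c0_norm u <= c.
Proof.
move=> H; apply: ge_sup; first by case: (c0_norm_has_sup u).
by move=> _ [n _ <-]; exact: H.
Qed.

Lemma ler_c0_normD u v : c0_norm (u + v) <= c0_norm u + c0_norm v.
Proof.
apply: c0_norm_le => n; apply: (le_trans (ler_normD _ _)).
by apply: lerD; exact: c0_norm_ub.
Qed.

Lemma c0_normZ (a : R) u : c0_norm (a *: u) = `|a| * c0_norm u.
Proof.
have le b v : c0_norm (b *: v) <= `|b| * c0_norm v.
  apply: c0_norm_le => n; rewrite [(b *: v) n]/(b * v n) normrM.
  by rewrite ler_wpM2l//; exact: c0_norm_ub.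
apply/eqP; rewrite eq_le le /=.
have [->|a0] := eqVneq a 0.
  by rewrite normr0 mul0r; apply: le_trans (c0_norm_ub (0 *: u) 0%N).
have na : 0 < `|a| by rewrite normr_gt0.
rewrite -ler_pdivlMl// -normfV.
by have := le a^-1 (a *: u); rewrite scalerA mulVf// scale1r.
Qed.

Lemma c0_norm0_eq0 u : c0_norm u = 0 -> u = 0.
Proof.
move=> u0; apply/val_inj/funext => n /=; apply/eqP; rewrite -normr_le0.
by have := c0_norm_ub u n; rewrite u0.
Qed.

HB.instance Definition _ := Lmodule_isNormed.Build R c0
  ler_c0_normD c0_normZ c0_norm0_eq0.

Lemma c0_normE (u : c0) : `|u| = sup (range (fun n => `|u n|)).
Proof. by []. Qed.

End C0.

(* Some closed subspace of X, namely [range T], is linearly homeomorphic to E. *)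
Definition contains_isomorphic_copy (R : realType) (E X : normedModType R) :=
  exists (T : {linear E -> X}) (S : X -> E),
    [/\ closed (range T), continuous T, cancel T S
      & {within range T, continuous S}].

Section Renorming.
Context {R : realType} (X : normedModType R).

Record equivalent_norm := EquivalentNorm {
  enorm :> X -> R ;
  ler_enormD : forall x y, enorm (x + y) <= enorm x + enorm y ;
  enormZ : forall (a : R) x, enorm (a *: x) = `|a| * enorm x ;
  enorm0_eq0 : forall x, enorm x = 0 -> x = 0 ;
  enorm_equiv : exists c C : R,
    [/\ 0 < c, 0 < C & forall x, c * `|x| <= enorm x <= C * `|x|]
}.

(* The vector space X with N as its norm in place of the original one. *)
Definition renorm (N : equivalent_norm) : Type := X.

Variable N : equivalent_norm.

HB.instance Definition _ := GRing.Lmodule.copy (renorm N) X.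
HB.instance Definition _ := Lmodule_isNormed.Build R (renorm N)
  (ler_enormD N) (enormZ N) (@enorm0_eq0 N).

Lemma renormE (x : renorm N) : `|x| = N x.
Proof. by []. Qed.

End Renorming.

(* Main.v *)
Require Import Defs.
From HB Require Import structures.
From mathcomp Require Import all_boot all_order all_algebra.
From mathcomp Require Import all_classical all_reals all_analysis.
From mathcomp Require Import lra.

Import Order.TTheory GRing.Theory Num.Theory.
Import numFieldNormedType.Exports.
Local Open Scope ring_scope.
Local Open Scope classical_set_scope.

(** Write T : c0 -> X for the embedding and e_j = T(delta_j), and fix a free
    ultrafilter U on nat.  The coordinate functionals of T(c0) extend to uniformly
    bounded t_j in X* ([bounded_extension]).  Subtracting their weak* limit
    along U gives functionals g_j = t_j - lim_U t_i which still read off the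
    coordinates on T(c0), because elements of c0 tend to 0, and which now tend to
    0 along U at EVERY point of X.  The new norm is

        |x| = max (sup_j |g_j x|) (dist (x, T(c0)))

    ([exists_coordinate_renorming]).  Adding a finite sum of e_j's to x leaves the
    distance term alone and increases by 1 only the coordinates g_j x of
    the e_j's that occur.  So if all those coordinates are at most d in modulus,
    the new norm of the sum is at most max |x| (1 + d).

    For A a set of naturals let f_A in X** be the weak* limit of the partial sums
    of sum_(j in A) e_j ([exists_bidual_indicator]).  The set A_d = {j : |g_j x| <= d}
    belongs to U, and |x + f_A| <= max |x| (1 + d) for every A contained in A_d.
    Hence a weak* limit h in X**** of the f_A, as A shrinks along U, satisfies
    |x + h| <= max |x| 1 for all x.  On the other hand f_A(g_j) is 1 or 0 according
    to whether j is in A, so the weak* limit phi in X*** of the g_j along U, which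
    has norm at most 1, takes the value 1 at every f_A with A in U.  Thus
    h(phi) = 1 and |h| >= 1.

    The reverse inequality is convexity ([max_norm_by_convexity]): both x + h and
    -x + h have norm at most max |x| 1, half their sum is h and half their
    difference is x, so neither of them can be shorter than that.

    The f_A are there because the e_j's themselves are weakly null: their weak*
    limit in X** is 0, whereas phi separates h from 0. *)

Set Implicit Arguments.
Unset Strict Implicit.
Unset Printing Implicit Defensive.

(** * Sublinear functionals and the Hahn-Banach theorem *)

Section Sublinear.
Context {R : realType} {V : lmodType R}.
Implicit Types (p q : V -> R) (D : set (V * R)).

Definition sublinear p :=
  (forall x y, p (x + y) <= p x + p y) /\
  (forall t x, 0 < t -> p (t *: x) <= t * p x).

Lemma sublinear0 p : sublinear p -> p 0 = 0.
Proof.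
move=> [_ pZ].
have := pZ 2 0 ltac:(lra); have := pZ 2^-1 0 ltac:(lra); rewrite !scaler0; lra.
Qed.

Lemma sublinearN p x : sublinear p -> - p (- x) <= p x.
Proof.
by move=> ps; have := ps.1 x (- x); rewrite subrr sublinear0// => ?; lra.
Qed.

Lemma sublinearZ p t x : sublinear p -> 0 <= t -> p (t *: x) = t * p x.
Proof.
move=> ps; rewrite le_eqVlt => /predU1P[<-|t0].
  by rewrite scale0r mul0r sublinear0.
apply/eqP; rewrite eq_le ps.2//=.
have := ps.2 t^-1 (t *: x); rewrite invr_gt0 scalerA mulVf ?gt_eqF// scale1r.
by move=> /(_ t0); rewrite -ler_pdivlMl.
Qed.

Lemma even_sublinearZ p a x : sublinear p -> (forall x, p (- x) = p x) ->
  p (a *: x) = `|a| * p x.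
Proof.
move=> ps pN; have [a0|/ltW a0] := leP 0 a; first by rewrite sublinearZ ?ger0_norm.
rewrite -pN -scaleNr sublinearZ ?oppr_ge0 ?ler0_norm//.
Qed.

Definition convex_cone D :=
  [/\ D (0, 0), (forall z w, D z -> D w -> D (z.1 + w.1, z.2 + w.2)) &
      (forall t z, 0 < t -> D z -> D (t *: z.1, t * z.2))].

(** The largest sublinear functional q below p such that q (- y) <= r for all
    (y, r) in the cone D.  It serves to impose constraints on p, and with all
    r = 0 it is the quotient seminorm modulo a subspace. *)
Definition cone_inf p D x := inf [set p (x + z.1) + z.2 | z in D].

Section ConeInf.
Variables (p : V -> R) (D : set (V * R)).
Hypotheses (ps : sublinear p) (Dc : convex_cone D).
Hypothesis (pD : forall z, D z -> 0 <= p z.1 + z.2).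

Lemma cone_inf_le x z : D z -> cone_inf p D x <= p (x + z.1) + z.2.
Proof.
move=> Dz; apply: ge_inf; last by exists z.
exists (- p (- x)) => _ [w Dw <-].
by have := ps.1 (- x) (x + w.1); rewrite addKr => ?; have := pD Dw; lra.
Qed.

Lemma le_cone_inf x c : (forall z, D z -> c <= p (x + z.1) + z.2) ->
  c <= cone_inf p D x.
Proof.
case: Dc => D0 _ _ H; apply: lb_le_inf; last by move=> _ [z Dz <-]; exact: H.
by exists (p (x + 0) + 0), (0, 0).
Qed.

Lemma cone_inf_dominated x : cone_inf p D x <= p x.
Proof. by case: Dc => /(cone_inf_le x)/=; rewrite !addr0. Qed.

Lemma cone_infN z : D z -> cone_inf p D (- z.1) <= z.2.
Proof. by move=> /(cone_inf_le (- z.1)); rewrite addNr sublinear0// add0r. Qed.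

Lemma sublinear_cone_inf : sublinear (cone_inf p D).
Proof.
case: (Dc) => _ DD DZ; split=> [x y|t x t0].
  rewrite -lerBlDr; apply: le_cone_inf => z Dz.
  rewrite lerBlDr -lerBlDl; apply: le_cone_inf => w Dw.
  have := cone_inf_le (x + y) (DD _ _ Dz Dw); rewrite /= addrACA.
  by have := ps.1 (x + z.1) (y + w.1); lra.
rewrite -ler_pdivrMl//; apply: le_cone_inf => z Dz.
rewrite ler_pdivrMl//.
have := cone_inf_le (t *: x) (DZ _ _ t0 Dz); rewrite /= -scalerDr.
by have := ps.2 t (x + z.1) t0; rewrite mulrDr; lra.
Qed.

End ConeInf.

(** Zorn's lemma: the infimum of a chain of sublinear functionals below p is
    finite, as each q of the chain has q x >= - q (- x) >= - p (- x), and it is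
    subadditive because two members of a chain are comparable. *)
Lemma minimal_sublinear p : sublinear p ->
  exists q, [/\ sublinear q, forall x, q x <= p x &
    forall r, sublinear r -> (forall x, r x <= q x) -> r = q].
Proof.
move=> ps; pose T := {q : V -> R | sublinear q /\ forall x, q x <= p x}.
pose le (q r : T) := `[< forall x, sval r x <= sval q x >].
have [||||[q [qs qp]] qmin] := @Zorn T le.
- by move=> q; apply/asboolP.
- move=> q r s /asboolP qr /asboolP rs; apply/asboolP => x.
  exact: le_trans (rs x) (qr x).
- move=> [q Hq] [r Hr] /asboolP/= qr /asboolP/= rq.
  have E : q = r by apply/funext => x; apply/eqP; rewrite eq_le qr rq.
  by move: Hq; rewrite E => Hq; rewrite (Prop_irrelevance Hq Hr).
- move=> A Atot; have [[a Aa]|A0] := pselect (A !=set0); last first.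
    exists (exist _ p (conj ps (fun=> lexx _))) => s As.
    by case: A0; exists s.
  pose m x := inf [set sval s x | s in A].
  have m_le s x : A s -> m x <= sval s x.
    move=> As; apply: ge_inf; last by exists s.
    exists (- p (- x)) => _ [[r [rs rp]] _ <-] /=.
    by have := sublinearN x rs; have := rp (- x); lra.
  have le_m c x : (forall s, A s -> c <= sval s x) -> c <= m x.
    move=> H; apply: lb_le_inf; first by exists (sval a x), a.
    by move=> _ [s As <-]; exact: H.
  have ms : sublinear m.
    split=> [x y|t x t0].
      rewrite -lerBlDr; apply: (le_m) => s As.
      rewrite lerBlDr -lerBlDl; apply: (le_m) => r Ar; rewrite lerBlDl.
      have [/asboolP H|/asboolP H] := Atot _ _ As Ar.
        have := m_le _ (x + y) Ar; have := (svalP r).1.1 x y; have := H x; lra.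
      have := m_le _ (x + y) As; have := (svalP s).1.1 x y; have := H y; lra.
    rewrite -ler_pdivrMl//; apply: (le_m) => s As; rewrite ler_pdivrMl//.
    exact: le_trans (m_le _ _ As) ((svalP s).1.2 _ _ t0).
  have mp x : m x <= p x := le_trans (m_le _ x Aa) ((svalP a).2 x).
  by exists (exist _ m (conj ms mp)) => s As; apply/asboolP => x; exact: m_le.
exists q; split=> // r rs rq.
have rp x : r x <= p x := le_trans (rq x) (qp x).
by have [] := qmin (exist _ r (conj rs rp)) (introT (asboolP _) rq).
Qed.

(** Sublinear functionals that are minimal are odd, hence linear: imposing the
    value - q a at - a on q gives a sublinear functional below q, thus q itself. *)
Lemma minimal_sublinear_linear q : sublinear q ->
  (forall r, sublinear r -> (forall x, r x <= q x) -> r = q) ->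
  linear (q : V -> R^o).
Proof.
move=> qs qmin.
have qN a : q (- a) = - q a.
  pose D := [set z : V * R | exists2 t, 0 <= t & z = (t *: a, - (t * q a))].
  have Dc : convex_cone D.
    split; first by exists 0; rewrite // scale0r mul0r oppr0.
      move=> _ _ [t t0 ->] [s s0 ->]; exists (t + s); first exact: addr_ge0.
      by rewrite /= scalerDl mulrDl opprD.
    move=> t _ t0 [s s0 ->]; exists (t * s); first by rewrite mulr_ge0// ltW.
    by rewrite /= scalerA mulrN mulrA.
  have qD z : D z -> 0 <= q z.1 + z.2.
    by move=> [t t0 ->]; rewrite /= sublinearZ// subrr.
  have Da : D (a, - q a) by exists 1; rewrite // scale1r mul1r.
  have := cone_infN qs qD Da.
  rewrite (qmin _ (sublinear_cone_inf qs Dc qD)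
    (cone_inf_dominated qs Dc qD)) /= => qa.
  by apply/eqP; rewrite eq_le qa; have := sublinearN a qs; lra.
have qD x y : q (x + y) = q x + q y.
  have := qs.1 (x + y) (- y); rewrite addrK qN => H.
  by apply/eqP; rewrite eq_le qs.1; lra.
have qZ a x : q (a *: x) = a * q x.
  have [a0|/ltW a0] := leP 0 a; first exact: sublinearZ.
  by rewrite -[a]opprK scaleNr qN sublinearZ ?oppr_ge0// !mulNr.
by move=> a x y; rewrite qD qZ.
Qed.

Lemma linear_rules (W : lmodType R) (f : V -> W) : linear f ->
  [/\ f 0 = 0, forall x y, f (x + y) = f x + f y &
      forall (a : R) x, f (a *: x) = a *: f x].
Proof.
move=> fl; have f0 : f 0 = 0.
  by have := fl (-1) 0 0; rewrite scaler0 addr0 scaleN1r addNr.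
split=> // [x y|a x]; first by have := fl 1 x y; rewrite !scale1r.
by have := fl a x 0; rewrite !addr0 f0 addr0.
Qed.

(** The constraints form a cone rather than the graph of a functional on a
    subspace.  The classical extension of phi is the case where D consists of
    the pairs (y, - phi y).  A functional as claimed is a minimal sublinear
    functional below [cone_inf p D]. *)
Lemma hahn_banach_cone p D : sublinear p -> convex_cone D ->
  (forall z, D z -> 0 <= p z.1 + z.2) ->
  exists f : V -> R^o, [/\ linear f, forall x, f x <= p x &
    forall z, D z -> - f z.1 <= z.2].
Proof.
move=> ps Dc pD.
have [f [fs fp fmin]] := minimal_sublinear (sublinear_cone_inf ps Dc pD).
have fl := minimal_sublinear_linear fs fmin.
exists f; split=> //.
  move=> x; exact: le_trans (fp x) (cone_inf_dominated ps Dc pD x).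
move=> z Dz; apply: le_trans (cone_infN ps pD Dz).
apply: le_trans (fp _).
by have [_ _ fZ] := linear_rules fl; rewrite -scaleN1r fZ scaleN1r.
Qed.

End Sublinear.

(** * Functionals on a normed space *)

Lemma ultra_fmap (I J : Type) (f : I -> J) (U : set_system I) :
  UltraFilter U -> UltraFilter (f x @[x --> U]).
Proof.
move=> UU; split=> [|G GF UG]; first exact: fmap_proper_filter.
apply/seteqP; split=> // B GB.
have [//|UnB] := in_ultra_setVsetC (f @^-1` B) UU.
have /UG GnB : (f x @[x --> U]) (~` B) by [].
by have [y []] := filter_ex (filterI GB GnB).
Qed.

Section DualTools.
Context {R : realType} {E : normedModType R}.

Lemma bounded_in_dual (f : E -> R^o) (M : R) :
  linear f -> (forall x, `|f x| <= M * `|x|) -> f \in dual_pred (X := E).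
Proof.
move=> fl fM; apply/mem_set; split=> //.
pose g : {linear E -> R^o} := HB.pack f (GRing.isLinear.Build _ _ _ _ _ fl).
suff : continuous g by [].
apply/linear_bounded_continuous/bounded_funP => r.
exists (`|M| * r) => x xr; apply: le_trans (fM x) _.
apply: (@le_trans _ _ (`|M| * `|x|)); first by rewrite ler_wpM2r// ler_norm.
by rewrite ler_wpM2l.
Qed.

Lemma dual_norm_le_bound (f : dual E) (M : R) : 0 <= M ->
  (forall x, `|f x| <= M * `|x|) -> `|f| <= M.
Proof.
move=> M0 fM; apply: dual_norm_le => x x1; apply: le_trans (fM x) _.
by rewrite ler_piMr.
Qed.

Lemma dualD (f : dual E) x y : f (x + y) = f x + f y.
Proof. by have := dual_linear f 1 x y; rewrite !scale1r. Qed.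

Lemma dual_apply_le (f : dual E) x (c : R) : `|x| <= c -> `|f x| <= c * `|f|.
Proof.
move=> xc; apply: le_trans (dual_norm_apply f x) _.
by rewrite mulrC; exact: (ler_wpM2r (normr_ge0 f) xc).
Qed.

End DualTools.

Section HahnBanach.
Context {R : realType} {E : normedModType R}.

(** Hahn-Banach with p = K |x|.  The functional phi is given on the domain of T
    instead of its range; the bound makes it factor through T. *)
Lemma bounded_extension (F : lmodType R) (T : F -> E) (phi : F -> R^o) (K : R) :
  0 <= K -> linear T -> linear phi -> (forall u, `|phi u| <= K * `|T u|) ->
  exists t : dual E, (forall x, `|t x| <= K * `|x|) /\
                     (forall u, t (T u) = phi u).
Proof.
move=> K0 Tl phil phiK.
have [T0 TD TZ] := linear_rules Tl.
have [phi0 phiD phiZ] := linear_rules phil.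
pose p (x : E) : R := K * `|x|.
have ps : sublinear p.
  split=> [x y|t x t0]; first by rewrite -mulrDr ler_wpM2l// ler_normD.
  by rewrite /p normrZ gtr0_norm// mulrCA.
pose D := [set z : E * R | exists u, z = (T u, - phi u)].
have Dc : convex_cone D.
  split; first by exists 0; rewrite T0 phi0 oppr0.
    by move=> _ _ [u ->] [v ->]; exists (u + v); rewrite /= TD phiD opprD.
  by move=> t _ t0 [u ->]; exists (t *: u); rewrite /= TZ phiZ -mulrN.
have pD z : D z -> 0 <= p z.1 + z.2.
  by move=> [u ->]; rewrite /= subr_ge0; exact: le_trans (ler_norm _) (phiK u).
have [f [fl fp fD]] := hahn_banach_cone ps Dc pD.
have fN x : f (- x) = - f x.
  by have [_ _ fZ] := linear_rules fl; rewrite -scaleN1r fZ scaleN1r.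
have fK x : `|f x| <= K * `|x|.
  rewrite ler_norml fp andbT; have := fp (- x); rewrite fN /p normrN.
  by rewrite lerNl.
exists (Dual (bounded_in_dual fl fK)); split=> //= u.
apply/eqP; rewrite eq_le; apply/andP; split; last first.
  by have := fD (T u, - phi u) (ex_intro _ u erefl); rewrite /= lerN2.
have := fD (T (- u), - phi (- u)) (ex_intro _ (- u) erefl).
by rewrite -scaleN1r TZ phiZ !scaleN1r /= fN !opprK.
Qed.

(** Extension of the functional r x |-> r |x| from the line through x. *)
Lemma norming_functional (x : E) : exists f : dual E, `|f| <= 1 /\ f x = `|x|.
Proof.
have [||||f [f1 fx]] := @bounded_extension R^o (fun r => r *: x)
   (fun r => r * `|x|) 1; rewrite ?ler01//.
- by move=> a r s; rewrite scalerDl scalerA.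
- by move=> a r s; rewrite mulrDl -mulrA.
- by move=> r; rewrite normrM normr_id mul1r normrZ.
exists f; split; first exact: (dual_norm_le_bound ler01 f1).
by have := fx 1; rewrite scale1r mul1r.
Qed.

Lemma norm_bidual_embed (x : E) : `|bidual_embed x| = `|x|.
Proof.
apply/eqP; rewrite eq_le; apply/andP; split.
  apply: dual_norm_le_bound => // f; exact: (dual_apply_le f (lexx `|x|)).
have [f [f1 <-]] := norming_functional x.
apply: le_trans (ler_norm _) _.
by have := dual_apply_le (bidual_embed x) f1; rewrite mul1r.
Qed.

Lemma bidual_embedN (x : E) : bidual_embed (- x) = - bidual_embed x.
Proof.
by apply/val_inj/funext => f /=; rewrite -[- x]scaleN1r dualZ scaleN1r.
Qed.

(** Weak* compactness of bounded sets of functionals: pointwise limits along an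
    ultrafilter exist by compactness of segments, and inherit linearity and the
    bound. *)
Lemma dual_ultralimit (I : Type) (U : set_system I) (f : I -> dual E) (M : R) :
  UltraFilter U -> (forall i x, `|f i x| <= M * `|x|) ->
  exists L : dual E, (forall x, `|L x| <= M * `|x|) /\
    forall x, (f i x : R^o) @[i --> U] --> (L x : R^o).
Proof.
move=> UU fM.
have cv x : exists l : R^o, (f i x : R^o) @[i --> U] --> l /\ `|l| <= M * `|x|.
  have := @segment_compact R (- (M * `|x|)) (M * `|x|).
  rewrite compact_ultra => /(_ ((f i x : R^o) @[i --> U]) (ultra_fmap _ UU))[].
    by apply: nearW => i /=; rewrite in_itv/= -ler_norml.
  move=> l [/=]; rewrite in_itv/= -ler_norml => lM fl.
  by exists l.
have [L /all_and2[LU LM]] := choice cv.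
have Ll : linear L.
  move=> a x y; apply: (@cvg_unique _ _ ((f i (a *: x + y) : R^o) @[i --> U])).
  - exact: norm_hausdorff.
  - exact: LU.
  have -> : (fun i => f i (a *: x + y) : R^o) =
            (fun i => a *: (f i x : R^o) + (f i y : R^o)).
    by apply/funext => i; rewrite (dual_linear (f i)).
  by apply: cvgD; [apply: cvgZl_tmp|]; exact: LU.
by exists (Dual (bounded_in_dual Ll LM)).
Qed.

End HahnBanach.

(** * The element of the fourth dual *)

Section FourthDual.
Context {R : realType} {W : normedModType R}.

Definition partial_sum (e : nat -> W) (A : set nat) n : W :=
  \sum_(j < n | (j : nat) \in A) e j.

Lemma biorthogonal_partial_sum (e : nat -> W) (g : nat -> dual W) A n i :
  (forall i j, g i (e j) = (i == j)%:R) ->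
  g i (partial_sum e A n) = ((i < n)%N && (i \in A))%:R.
Proof.
move=> ge; rewrite /partial_sum (big_morph (g i) (dualD (g i)) (dual0 (g i))).
under eq_bigr do rewrite ge.
have [ilen|nilen] := ltnP i n => /=; last first.
  by apply: big1 => j _; rewrite gtn_eqF// (leq_trans (ltn_ord j)).
have [iA|iA] := boolP (i \in A).
  rewrite (bigD1 (Ordinal ilen))//= eqxx big1 ?addr0// => j /andP[_ ji].
  by rewrite eq_sym; case: eqP => // /esym ij; rewrite -val_eqE/= ij eqxx in ji.
by apply: big1 => j jA; case: eqP => // ij; rewrite ij jA in iA.
Qed.

(** The two upper bounds force equality, since 2 h = (x + h) + (- x + h) and
    2 x = (x + h) - (- x + h). *)
Lemma max_norm_by_convexity (h : W) (x : W) : 1 <= `|h| ->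
  `|x + h| <= Num.max `|x| 1 -> `|- x + h| <= Num.max `|x| 1 ->
  `|x + h| = Num.max `|x| 1.
Proof.
move=> h1 xh nxh; apply/eqP; rewrite eq_le xh /= ge_max.
have hsum : 2 * `|h| <= `|x + h| + `|- x + h|.
  rewrite -[2]ger0_norm// -normrZ scaler_nat mulr2n.
  by have -> : h + h = (x + h) + (- x + h); [rewrite addrACA subrr add0r|exact: ler_normD].
have xsum : 2 * `|x| <= `|x + h| + `|- x + h|.
  rewrite -[2]ger0_norm// -normrZ scaler_nat mulr2n -[`|- x + h|]normrN.
  have -> : x + x = (x + h) + - (- x + h); last exact: ler_normD.
  by rewrite opprD opprK addrACA subrr addr0.
by move: nxh; rewrite maxEle; case: ifP => x1 nxh; apply/andP; split; lra.
Qed.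

End FourthDual.

Section Main.
Context {R : realType} {W : normedModType R}.
Variables (U : set_system nat) (UU : UltraFilter U) (Ufree : \oo `<=` U).
Variables (e : nat -> W) (g : nat -> dual W).
Hypothesis ge : forall i j, g i (e j) = (i == j)%:R.
Hypothesis g_le : forall j x, `|g j x| <= `|x|.
Hypothesis gU : forall x, (g j x : R^o) @[j --> U] --> (0 : R^o).
(* The bound is applied to sets A on which g_j x is small, with c close to 1. *)
Hypothesis norm_add_partial_sum : forall (A : set nat) n (x : W) (c : R),
  (forall j, A j -> `|g j x + 1| <= c) ->
  `|x + partial_sum e A n| <= Num.max `|x| c.

(** The functional f plays the role of the indicator of A, an element of
    l^infty = c0**, and weak* limits preserve the bound on x + partial sums. *)
Lemma exists_bidual_indicator (A : set nat) : exists f : dual (dual W),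
  [/\ `|f| <= 1,
      forall i, f (g i) = (i \in A)%:R &
      forall (x : W) (c : R), (forall j, A j -> `|g j x + 1| <= c) ->
        `|bidual_embed x + f| <= Num.max `|x| c].
Proof.
have s1 n : `|partial_sum e A n| <= 1.
  have := @norm_add_partial_sum A n 0 1; rewrite add0r normr0 max_r//; apply.
  by move=> j _; rewrite dual0 add0r normr1.
have [n phi|f [f1 fU]] := dual_ultralimit
  (f := fun n => bidual_embed (partial_sum e A n)) (M := 1) UU.
  exact: (dual_apply_le phi (s1 n)).
exists f; split; first exact: dual_norm_le_bound f1.
- move=> i; apply: (@cvg_unique _ _
    ((g i (partial_sum e A n) : R^o) @[n --> U])).
  + exact: norm_hausdorff.
  + exact: fU.
  + apply: cvg_near_cst; apply: Ufree; exists i.+1 => // n /= ilen.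
    by rewrite biorthogonal_partial_sum// ilen.
- move=> x c Ac; apply: dual_norm_le_bound => [|phi].
    by rewrite le_max normr_ge0.
  have cv : (`|phi (x + partial_sum e A n)| : R^o) @[n --> U] -->
     (`|(bidual_embed x + f) phi| : R^o).
    apply: cvg_norm; under eq_fun do rewrite dualD.
    by apply: cvgD; [exact: cvg_cst|exact: fU].
  apply: (cvgr_to_le cv); apply: nearW => n.
  by apply: dual_apply_le; exact: norm_add_partial_sum.
Qed.

Lemma exists_fourth_dual_max : exists h : dual (dual (dual (dual W))),
  `|h| = 1 /\ forall x : W, `|bidual_embed (bidual_embed x) + h| = Num.max `|x| 1.
Proof.
have [f /all_and3[f1 fg fx]] := choice exists_bidual_indicator.
(* The functional that witnesses |h| >= 1: the limit of the g_j along U. *)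
have [phi [phi1 phiU]] : exists phi : dual (dual (dual W)), `|phi| <= 1 /\
    forall A, U A -> phi (f A) = 1.
  have [n xi|phi [phi1 phiU]] := dual_ultralimit
    (f := fun j => bidual_embed (g j)) (M := 1) UU.
    apply: (@dual_apply_le _ _ xi (g n)); apply: dual_norm_le_bound => // x.
    by rewrite mul1r.
  exists phi; split; first exact: dual_norm_le_bound phi1.
  move=> A UA; apply: (@cvg_unique _ _ ((f A (g j) : R^o) @[j --> U])).
  + exact: norm_hausdorff.
  + exact: phiU.
  + apply: cvg_near_cst; apply: filterS UA => j Aj.
    by rewrite fg mem_set.
(* A member of V is a set of small members of U, so a limit along V is a limit
   as the sets A of U shrink. *)
have [V [UV sV]] := ultraFilterLemma (powerset_filter_from_filter (@ultra_proper _ U UU)).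
have VP (P : set nat -> Prop) A : U A -> (forall B, U B -> B `<=` A -> P B) ->
    \forall B \near V, P B.
  move=> UA AP; apply: sV; near=> B; apply: AP.
    by near: B; exact: near_small_set.
  by near: B; exact: small_set_sub.
have [A psi|h [h1 hV]] := dual_ultralimit
    (f := fun A => bidual_embed (f A)) (M := 1) UV.
  exact: (dual_apply_le psi (f1 A)).
have h_le x : `|bidual_embed (bidual_embed x) + h| <= Num.max `|x| 1.
  apply/ler_addgt0Pr => d d0.
  have m0 : 0 <= Num.max `|x| 1 + d by rewrite addr_ge0 ?le_max ?normr_ge0// ltW.
  apply: dual_norm_le_bound => // psi.
  have cv : (`|psi (bidual_embed x + f A)| : R^o) @[A --> V] -->
     (`|(bidual_embed (bidual_embed x) + h) psi| : R^o).
    apply: cvg_norm; under eq_fun do rewrite dualD.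
    by apply: cvgD; [exact: cvg_cst|exact: hV].
  apply: (cvgr_to_le cv).
  have UA : U [set j | `|g j x| <= d].
    exact: cvgr0_norm_le (gU x) _ d0.
  apply: (VP _ _ UA) => B UB BA.
  apply: dual_apply_le; apply: (le_trans (fx B x (1 + d) _)).
    move=> j /BA /= jd; apply: le_trans (ler_normD _ _) _.
    by rewrite normr1 addrC lerD2l.
  rewrite ge_max !maxEle; case: ifP => ?; lra.
have h_ge : 1 <= `|h|.
  have hphi : h phi = 1.
    apply: (@cvg_unique _ _ ((phi (f A) : R^o) @[A --> V])).
    + exact: norm_hausdorff.
    + exact: hV.
    + apply: cvg_near_cst; apply: (VP _ setT filterT) => B UB _; exact: phiU.
  by have := dual_apply_le h phi1; rewrite hphi normr1 mul1r.
exists h; split.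
  apply/eqP; rewrite eq_le h_ge andbT; exact: dual_norm_le_bound h1.
move=> x.
have := @max_norm_by_convexity _ _ h (bidual_embed (bidual_embed x)) h_ge.
rewrite !norm_bidual_embed; apply => //.
have := h_le (- x); rewrite !bidual_embedN normrN; exact.
Unshelve. all: by end_near.
Qed.

End Main.

(** * Embeddings of c0 *)

Section C0Tools.
Context {R : realType}.

Lemma c0_unit_subproof (j : nat) :
  (fun n => (n == j)%:R : R^o) \in c0_pred (R := R).
Proof.
apply/mem_set => /=; apply: cvg_near_cst; exists j.+1 => // n /= jn.
by rewrite gtn_eqF.
Qed.

Definition c0_unit (j : nat) : c0 R := C0 (c0_unit_subproof j).

Lemma embedding_bounds (X : normedModType R) (T : {linear c0 R -> X})
    (S : X -> c0 R) :
  continuous T -> cancel T S -> {within range T, continuous S} ->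
  exists M K : R, [/\ 0 <= M, 0 <= K, (forall u, `|T u| <= M * `|u|) &
    (forall u, `|u| <= K * `|T u|)].
Proof.
move=> Tc TS Sc.
have [M [M0 TM]] : exists M : R, 0 <= M /\ forall u, `|T u| <= M * `|u|.
  move/linear_bounded_continuous : Tc => /linear_boundedP/pinfty_ex_gt0[M M0 TM].
  by exists M; split; first exact: ltW.
(* Continuity of the inverse at 0; scaling then gives the constant 2 / d. *)
have [d d0 Sd] : exists2 d : R, 0 < d & forall u, `|T u| < d -> `|u| < 1.
  have T0 : range T (T 0) by exists 0.
  have /(_ (T 0)) := (subspace_continuousP _ _).1 Sc.
  move=> /(_ T0) /cvgr_dist_lt /(_ 1 ltr01).
  rewrite /from_subspace TS linear0 => /nbhs_norm0P[d /= d0 H]; exists d => // u Tud.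
  by have := H (T u) Tud (ex_intro2 _ _ u I erefl); rewrite TS sub0r normrN.
exists M, (2 / d); split=> //; first by rewrite divr_ge0// ltW.
move=> u; have [->|u0] := eqVneq u 0; first by rewrite linear0 !normr0 mulr0.
have nu : 0 < `|u| by rewrite normr_gt0.
rewrite leNgt; apply/negP => uT.
have : `|T (`|u|^-1 *: u)| < d.
  rewrite linearZ normrZ normfV normr_id mulrC ltr_pdivrMr//.
  have Tu0 : 0 <= `|T u| by [].
  move: uT; rewrite mulrAC ltr_pdivrMr// (mulrC d); lra.
by move=> /Sd; rewrite normrZ normfV normr_id mulVf ?gt_eqF// ltxx.
Qed.

End C0Tools.

(** * The renorming *)

Section Renorming.
Context {R : realType} {X : normedModType R}.
Variables (T : {linear c0 R -> X}) (g : nat -> dual X) (M K : R).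
Hypotheses (M0 : 0 <= M) (K0 : 0 <= K).
Hypothesis TM : forall u, `|T u| <= M * `|u|.
Hypothesis gK : forall j x, `|g j x| <= K * `|x|.
Hypothesis gT : forall j u, g j (T u) = u j.

Let coset_cone := [set z : X * R | exists u, z = (T u, 0)].
Let coset_norm (x : X) : R := cone_inf (fun y => `|y|) coset_cone x.
Let coord_norm (x : X) : R := sup (range (fun j => `|g j x|)).
Let new_norm (x : X) : R := Num.max (coord_norm x) (coset_norm x).

Let norm_sublinear : sublinear (fun y : X => `|y|).
Proof.
by split=> [x y|t x t0]; [exact: ler_normD|rewrite normrZ gtr0_norm].
Qed.

Let coset_cone_convex : convex_cone coset_cone.
Proof.
split; first by exists 0; rewrite linear0.
  by move=> _ _ [u ->] [v ->]; exists (u + v); rewrite linearD addr0.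
by move=> t _ t0 [u ->]; exists (t *: u); rewrite linearZ mulr0.
Qed.

Let coset_cone_ge0 z : coset_cone z -> 0 <= `|z.1| + z.2.
Proof. by move=> [u ->]; rewrite /= addr0. Qed.

Let coset_norm_sublinear : sublinear coset_norm.
Proof. exact: sublinear_cone_inf. Qed.

Let coset_norm_le x u : coset_norm x <= `|x + T u|.
Proof.
rewrite -[leRHS]addr0.
by apply: (cone_inf_le norm_sublinear coset_cone_ge0 x (z := (T u, 0))); exists u.
Qed.

Let le_coset_norm x c : (forall u, c <= `|x + T u|) -> c <= coset_norm x.
Proof.
move=> H; apply: (le_cone_inf coset_cone_convex) => _ [u ->].
by rewrite /= addr0.
Qed.

Let coset_normN x : coset_norm (- x) = coset_norm x.
Proof.
suff H y : coset_norm (- y) <= coset_norm y.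
  by apply/eqP; rewrite eq_le H -{1}[x]opprK H.
apply: le_coset_norm => u; rewrite -normrN opprD -linearN; exact: coset_norm_le.
Qed.

Let coset_normDr x u : coset_norm (x + T u) <= coset_norm x.
Proof.
apply: le_coset_norm => v.
by apply: le_trans (coset_norm_le _ (v - u)) _; rewrite -addrA -linearD subrKC.
Qed.

Let le_coord_norm x j : `|g j x| <= coord_norm x.
Proof.
apply: ub_le_sup; last by exists j.
by exists (K * `|x|) => _ [i _ <-].
Qed.

Let coord_norm_le x c : (forall j, `|g j x| <= c) -> coord_norm x <= c.
Proof.
move=> H; apply: ge_sup; first by exists `|g 0%N x|, 0%N.
by move=> _ [i _ <-].
Qed.

Let coord_norm_le_new x : coord_norm x <= new_norm x.
Proof. by rewrite le_max lexx. Qed.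

Let coset_norm_le_new x : coset_norm x <= new_norm x.
Proof. by rewrite le_max lexx orbT. Qed.

Let le_new_norm_coord x j : `|g j x| <= new_norm x.
Proof. exact: le_trans (le_coord_norm x j) (coord_norm_le_new x). Qed.

Let new_norm_sublinear : sublinear new_norm.
Proof.
split=> [x y|t x t0]; rewrite ge_max; apply/andP; split.
- apply: coord_norm_le => j; rewrite dualD; apply: le_trans (ler_normD _ _) _.
  exact: lerD (le_new_norm_coord _ _) (le_new_norm_coord _ _).
- apply: le_trans (coset_norm_sublinear.1 x y) _.
  exact: lerD (coset_norm_le_new _) (coset_norm_le_new _).
- apply: coord_norm_le => j; rewrite dualZ normrM gtr0_norm//.
  by apply: ler_wpM2l; [exact: ltW|exact: le_new_norm_coord].
- apply: le_trans (coset_norm_sublinear.2 t x t0) _.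
  by apply: ler_wpM2l; [exact: ltW|exact: coset_norm_le_new].
Qed.

Let new_normZ a x : new_norm (a *: x) = `|a| * new_norm x.
Proof.
have nN y : new_norm (- y) = new_norm y.
  rewrite /new_norm coset_normN /coord_norm.
  have -> // : (fun j => `|g j (- y)|) = (fun j => `|g j y|).
  by apply/funext => j; rewrite -scaleN1r dualZ normrM normrN1 mul1r.
exact: even_sublinearZ new_norm_sublinear nN.
Qed.

(** For every u the coordinates of u are differences of those of x + T u and of
    x, so |x| <= |x + T u| + M |u| is bounded in terms of |x + T u| and of the
    coordinates of x; the infimum over u turns |x + T u| into the distance. *)
Let le_new_norm x : `|x| <= (1 + M * K + M) * new_norm x.
Proof.
have cpos : 0 < 1 + M * K by have := mulr_ge0 M0 K0; lra.
have : (`|x| - M * coord_norm x) / (1 + M * K) <= coset_norm x.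
  apply: le_coset_norm => u; rewrite ler_pdivrMr//.
  have uj : `|u| <= K * `|x + T u| + coord_norm x.
    apply: c0_norm_le => j; rewrite -gT.
    have -> : g j (T u) = g j (x + T u) - g j x.
      by rewrite dualD addrAC subrr add0r.
    by apply: le_trans (ler_normB _ _) _; apply: lerD.
  have xu : `|x| <= `|x + T u| + `|T u|.
    by have := ler_normB (x + T u) (T u); rewrite addrK.
  have := TM u; have := ler_wpM2l M0 uj; lra.
rewrite ler_pdivrMr// => H.
have := ler_wpM2l M0 (coord_norm_le_new x).
have := ler_wpM2l (ltW cpos) (coset_norm_le_new x); lra.
Qed.

Let new_norm_le x : new_norm x <= (K + 1) * `|x|.
Proof.
rewrite ge_max mulrDl mul1r; apply/andP; split.
  by apply: coord_norm_le => j; rewrite ler_wpDr.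
have := coset_norm_le x 0; rewrite linear0 addr0 => /le_trans; apply.
by rewrite ler_wpDl// mulr_ge0.
Qed.

Let new_norm0_eq0 x : new_norm x = 0 -> x = 0.
Proof.
by move=> x0; have := le_new_norm x; rewrite x0 mulr0 normr_le0 => /eqP.
Qed.

Let new_norm_equiv : exists c C : R,
  [/\ 0 < c, 0 < C & forall x, c * `|x| <= new_norm x <= C * `|x|].
Proof.
have cpos : 0 < 1 + M * K + M by have := mulr_ge0 M0 K0; move: M0; lra.
exists (1 + M * K + M)^-1, (K + 1).
split; [by rewrite invr_gt0|exact: ltr_wpDl|].
by move=> x; rewrite new_norm_le ler_pdivrMl// le_new_norm.
Qed.

(** Translation by a sum of unit vectors T(delta_j) does not change the distance to
    the range of T, and it alters only the coordinates with index in A. *)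
Lemma exists_coordinate_renorming : exists N : equivalent_norm X,
  (forall j x, `|g j x| <= N x) /\
  (forall (A : set nat) n x (c : R), (forall j, A j -> `|g j x + 1| <= c) ->
    N (x + partial_sum (fun j => T (c0_unit j)) A n) <= Num.max (N x) c).
Proof.
exists (EquivalentNorm new_norm_sublinear.1 new_normZ new_norm0_eq0
  new_norm_equiv); split=> [j x|A n x c Ac] /=.
  exact: le_new_norm_coord.
rewrite ge_max; apply/andP; split.
  apply: coord_norm_le => j; rewrite dualD biorthogonal_partial_sum; last first.
    by move=> i k; rewrite gT.
  case: andP => [[_ /set_mem/Ac jc]|_]; first by rewrite le_max jc orbT.
  by rewrite addr0 le_max le_new_norm_coord.
rewrite /partial_sum -linear_sum; apply: le_trans (coset_normDr _ _) _.
by rewrite le_max coset_norm_le_new.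
Qed.

End Renorming.

(** * The theorem *)

Theorem theorem1p4 (R : realType) (X : completeNormedModType R)
    (hX : contains_isomorphic_copy (c0 R) X) :
  exists (N : equivalent_norm X) (h : dual (dual (dual (dual (renorm N))))),
    `|h| = 1 /\
    forall x : renorm N, `|bidual_embed (bidual_embed x) + h| = Num.max `|x| 1.
Proof.
have [T [S [_ Tc TS Sc]]] := hX.
have [M [K [M0 K0 TM TK]]] := embedding_bounds Tc TS Sc.
have [U [UU Ufree]] := ultraFilterLemma (@eventually_filter).
have ext j : exists t : dual X, (forall x, `|t x| <= K * `|x|) /\
    (forall u, t (T u) = u j).
  apply: bounded_extension => //; first exact: linearP.
  by move=> u; apply: le_trans (TK u); exact: c0_norm_ub.
have [t /all_and2[tK tT]] := choice ext.
(* Subtracting the limit mu makes the functionals null along U at every point,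
   without changing them on the range of T. *)
have [mu [muK muU]] := dual_ultralimit UU tK.
have muT u : mu (T u) = 0.
  apply: (@cvg_unique _ _ ((t j (T u) : R^o) @[j --> U])).
  - exact: norm_hausdorff.
  - exact: muU.
  have -> : (fun j => t j (T u) : R^o) = c0_seq u by apply/funext => j.
  by apply: cvg_trans (c0_cvg u); exact: cvg_app.
pose g j := t j - mu.
have gE j x : g j x = t j x - mu x by [].
have gT j u : g j (T u) = u j by rewrite gE tT muT subr0.
have gK j x : `|g j x| <= (K + K) * `|x|.
  by rewrite gE mulrDl; apply: le_trans (ler_normB _ _) _; exact: lerD.
have [N [gN NA]] := exists_coordinate_renorming M0 (addr_ge0 K0 K0) TM gK gT.
have gN_dual j : (g j : renorm N -> R^o) \in dual_pred (X := renorm N).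
  apply: (bounded_in_dual (M := 1)); first exact: (dual_linear (g j)).
  by move=> x; rewrite mul1r; exact: gN.
pose g' j : dual (renorm N) := Dual (gN_dual j).
exists N.
have ge i j : g' i (T (c0_unit j)) = (i == j)%:R by exact: gT (c0_unit j).
have g'0 x : (g' j x : R^o) @[j --> U] --> (0 : R^o).
  rewrite -[X in _ --> X](subrr (mu x)).
  by apply: cvgB; [exact: muU|exact: cvg_cst].
exact: (@exists_fourth_dual_max R (renorm N) U UU Ufree (fun j => T (c0_unit j))
  g' ge gN g'0 NA).
Qed.
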